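(* Let $\alpha$ be an ordinal and $\theta$ an infinite ordinal with $|\alpha|^++\aleph_0<\theta$. Let $\bar a\neq\bar b\in(\theta^{\underline{\alpha}})_<$ and let $G=((\theta^{\underline{\alpha}})_<,E_{\bar a,\bar b})$. If $\chi(G)>\beth_2(\aleph_0)$, then there is $m\in\mathbb{N}$, $m\ge1$, such that $G$ contains all finite subgraphs of $\mathrm{Sh}_m(\omega)$ (every finite subgraph of $\mathrm{Sh}_m(\omega)$ admits an injective graph homomorphism into $G$).
   Context: $(\theta^{\underline{\alpha}})_<$ is the set of strictly increasing functions $\alpha\to\theta$ (sequences $\bar c=\langle c_\beta:\beta<\alpha\rangle$). For $\bar c,\bar d,\bar a,\bar b\in(\theta^{\underline{\alpha}})_<$, write $\mathrm{otp}(\bar c,\bar d)=\mathrm{otp}(\bar a,\bar b)$ if the map $c_\beta\mapsto a_\beta$, $d_\beta\mapsto b_\beta$ ($\beta<\alpha$) is a well-defined order-isomorphism from $\mathrm{Rg}(\bar c)\cup\mathrm{Rg}(\bar d)$ onto $\mathrm{Rg}(\bar a)\cup\mathrm{Rg}(\bar b)$. The graph relation $E_{\bar a,\bar b}$ on $(\theta^{\underline{\alpha}})_<$ is: $\bar c\mathrel{E_{\bar a,\bar b}}\bar d$ iff $\mathrm{otp}(\bar c,\bar d)=\mathrm{otp}(\bar a,\bar b)$ or $\mathrm{otp}(\bar d,\bar c)=\mathrm{otp}(\bar a,\bar b)$. $\chi$ is the chromatic number. The shift graph $\mathrm{Sh}_r(A)$ has vertices the strictly increasing $r$-tuples from $A$,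 with $s,t$ adjacent iff $s(i)=t(i-1)$ for all $1\le i\le r-1$ or $t(i)=s(i-1)$ for all $1\le i\le r-1$ (complete graph on $A$ if $r=1$). *)

(* Defs.v *)
From mathcomp Require Import all_boot all_order.
From mathcomp Require Import boolp classical_sets functions cardinality wochoice.

Set Implicit Arguments.
Unset Strict Implicit.
Unset Printing Implicit Defensive.

Local Open Scope classical_set_scope.
Local Open Scope card_scope.
Local Open Scope order_scope.

(* An ordinal is represented by a well-ordered type of that order type; the
   notions below are invariant under order isomorphism. *)
Record ordinal_type := OrdinalType {
  ord_disp : Order.disp_t;
  ord_sort :> orderType ord_disp;
  ord_wo : well_order (<=%O : rel ord_sort)
}.

(* mu < theta: mu is order-isomorphic to a proper initial segment of theta. *)
Definition ord_lt (mu theta : ordinal_type) : Prop :=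
  exists (f : mu -> theta) (b : theta),
    {mono f : x y / x <= y} /\ range f = [set y | y < b].

Definition initial_ordinal (mu : ordinal_type) : Prop :=
  forall b : mu, ~ ([set y | y < b] #= [set: mu]).

(* Cardinals are represented by types, compared through injections. *)
Definition card_lt (K L : Type) : Prop :=
  [set: K] #<= [set: L] /\ ~ ([set: L] #<= [set: K]).

(* L has cardinality |K|^+. *)
Definition is_succ_card (K L : Type) : Prop :=
  card_lt K L /\ forall M : Type, card_lt K M -> [set: L] #<= [set: M].

(* mu is the cardinal |K|, as an ordinal. *)
Definition is_card_of (K : Type) (mu : ordinal_type) : Prop :=
  initial_ordinal mu /\ [set: mu] #= [set: K].

Fixpoint beth (n : nat) (K : Type) : Type :=
  if n is n'.+1 then set (beth n' K) else K.

Record graph := Graph {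
  vertex :> Type;
  adj : vertex -> vertex -> Prop;
  adj_sym : forall x y, adj x y -> adj y x;
  adj_irr : forall x, ~ adj x x
}.

Definition colorable (G : graph) (C : Type) : Prop :=
  exists c : G -> C, forall x y, adj x y -> c x <> c y.

Definition is_chromatic_number (G : graph) (C : Type) : Prop :=
  colorable G C /\ forall D : Type, colorable G D -> [set: C] #<= [set: D].

(* Subgraphs need not be induced. *)
Record subgraph (G : graph) := Subgraph {
  svert : set G;
  sadj : G -> G -> Prop;
  sadj_sym : forall x y, sadj x y -> sadj y x;
  sadj_sub : forall x y, sadj x y -> [/\ svert x, svert y & adj x y]
}.

Section SubgraphGraph.
Variables (G : graph) (H : subgraph G).

Let E (x y : svert H) : Prop := sadj H (val x) (val y).

Lemma subgraph_sym (x y : svert H) : E x y -> E y x.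
Proof. exact: sadj_sym. Qed.

Lemma subgraph_irr (x : svert H) : ~ E x x.
Proof. by move=> /sadj_sub[_ _] /adj_irr. Qed.

Definition graph_of_subgraph : graph := Graph subgraph_sym subgraph_irr.

End SubgraphGraph.

Definition injective_hom (H G : graph) (f : H -> G) : Prop :=
  injective f /\ forall x y, adj x y -> adj (f x) (f y).

Definition contains_finite_subgraphs (G S : graph) : Prop :=
  forall H : subgraph S, finite_set (svert H) ->
    exists f : graph_of_subgraph H -> G, injective_hom f.

Record incr_fun d d' (A : orderType d) (B : orderType d') := IncrFun {
  incr_val :> A -> B;
  incr_homo : {homo incr_val : x y / x < y}
}.

Lemma incr_fun_ext d d' (A : orderType d) (B : orderType d')
  (f g : incr_fun A B) : f =1 g -> f = g.
Proof.
case: f g => [f fP] [g gP] /= /funext fg; case: g / fg gP => gP.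
by congr IncrFun; exact: Prop_irrelevance.
Qed.

Section OtpGraph.
Variables (d d' : Order.disp_t) (A : orderType d) (T : orderType d').

(* The map is given by the restriction of f to the union of the ranges. *)
Definition same_otp (c e a b : incr_fun A T) : Prop :=
  exists f : T -> T,
    [/\ forall i, f (c i) = a i,
        forall i, f (e i) = b i,
        set_bij (range c `|` range e) (range a `|` range b) f
      & {in range c `|` range e &, {mono f : x y / x <= y}}].

Variables (a b : incr_fun A T) (ab : a <> b).

Let E (c e : incr_fun A T) : Prop := same_otp c e a b \/ same_otp e c a b.

Lemma otp_graph_sym c e : E c e -> E e c.
Proof. by case; [right|left]. Qed.

Lemma otp_graph_irr c : ~ E c c.
Proof.
suff H : ~ same_otp c c a b by case.
by move=> [f [fa fb _ _]]; apply/ab/incr_fun_ext => i; rewrite -fa -fb.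
Qed.

Definition otp_graph : graph := Graph otp_graph_sym otp_graph_irr.

End OtpGraph.

Section ShiftGraph.
Variables (r : nat) (d : Order.disp_t) (A : orderType d).

Let shifted (s t : incr_fun 'I_r A) : Prop :=
  forall i j : 'I_r, nat_of_ord i = (nat_of_ord j).+1 -> s i = t j.

(* For r >= 2 the conjunct s <> t is implied by the other one; for r = 1 the
   other one is vacuous, and the complete graph is obtained. *)
Let E (s t : incr_fun 'I_r A) : Prop :=
  s <> t /\ (shifted s t \/ shifted t s).

Lemma shift_graph_sym s t : E s t -> E t s.
Proof. by case=> st [h|h]; split; [move/esym|right|move/esym|left]. Qed.

Lemma shift_graph_irr s : ~ E s s.
Proof. by case. Qed.

Definition shift_graph : graph := Graph shift_graph_sym shift_graph_irr.

End ShiftGraph.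

(* Main.v *)
(* Put lo = min(a, b) and hi = max(a, b). The intervals [lo i, hi i] overlap in
   connected components on which a < b, a = b or b < a throughout, and the map
   sending i to the first j with lo i <= hi j turns each component into a tree
   with a unique vertex at level 0.

   If the levels are unbounded on the components with a < b, long branches give
   sequences i_0 < i_1 < ... with a_{i_{k+1}} <= b_{i_k} < a_{i_{k+2}}, so that
   adjacent vertices interleave along them. Comparing eventually along branches
   of increasing length, adjacent vertices are cofinal in each other, and the
   position of a vertex in a cofinal sequence fixed for its component is a proper
   colouring by functions from nat to nat. The components with b < a are dealt
   with by exchanging a and b.

   If m is the maximal level, a vertex s of Sh_{m+1}(omega) is mapped to
   i |-> (root i, s(level i), position of i in the post-order of its tree), ordered
   lexicographically: along an edge from s to t, s(k + 1) = t(k) puts the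
   vertices at level k + 1 for s into the column of the vertices at level k for t,
   among which are their parents, and post-order reproduces the comparison of
   lo i with hi j. The finitely many copies of alpha so obtained have a
   well-ordered union of cardinality smaller than mu, which embeds in mu. *)

Require Import Defs.
From mathcomp Require Import all_boot all_order.
From mathcomp Require Import boolp classical_sets functions cardinality.
From mathcomp Require Import zify.

Set Implicit Arguments.
Unset Strict Implicit.
Unset Printing Implicit Defensive.

Import Order.TTheory.

(** * Well-founded and lexicographic orders *)

Section WellOrder.
Local Open Scope order_scope.

Lemma ordinal_min (A : ordinal_type) (P : A -> Prop) :
  (exists x, P x) -> exists x, P x /\ forall y, P y -> x <= y.
Proof.
move=> [x Px]; have [|z [[Pz zmin] _]] := @ord_wo A [pred y | `[< P y >]].
  by exists x; apply/asboolP.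
exists z; split; first exact/asboolP.
by move=> y Py; apply: zmin; apply/asboolP.
Qed.

Lemma ordinal_wf (A : ordinal_type) : well_founded (fun x y : A => x < y).
Proof.
move=> x; apply: contrapT => nx.
have [z [nz zmin]] := ordinal_min (ex_intro (fun x => ~ Acc _ x) x nx).
apply: nz; split=> y yz; apply: contrapT => /zmin.
by rewrite leNgt yz.
Qed.

End WellOrder.

Section LexicographicOrder.
Local Open Scope order_scope.
Variables (E : Type) (ltE : E -> E -> Prop).

Definition ltlex (m : nat) (x y : nat -> E) : Prop :=
  exists2 r, (r < m)%N & (forall q, (q < r)%N -> x q = y q) /\ ltE (x r) (y r).

Lemma ltlex_trans m : (forall x y z, ltE x y -> ltE y z -> ltE x z) ->
  forall x y z, ltlex m x y -> ltlex m y z -> ltlex m x z.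
Proof.
move=> tr x y z [r rm [xy xyr]] [q qm [yz yzq]].
have [rq|qr|rq] := ltngtP r q.
- exists r => //; split=> [k kr|]; last by rewrite -yz.
  by rewrite xy // yz // (ltn_trans kr rq).
- exists q => //; split=> [k kq|]; last by rewrite xy.
  by rewrite xy ?yz // (ltn_trans kq qr).
- exists r => //; split=> [k kr|]; first by rewrite xy // yz // -rq.
  by apply: tr xyr _; rewrite rq.
Qed.

Lemma ltlex_wf m : well_founded ltE -> well_founded (ltlex m).
Proof.
move=> wfE; elim: m => [|m IHm] x; first by split=> y [].
elim/(well_founded_ind IHm): x => x IHx.
(* The outer induction is on the first [m] coordinates, the inner one on the value at [m]; later
   coordinates are invisible to the order. *)
suff H e : forall y, (forall q, (q < m)%N -> y q = x q) -> y m = e ->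
    Acc (ltlex m.+1) y by exact: (H _ x).
elim/(well_founded_ind wfE): e => e IHe y yx ye; split=> z [r].
rewrite ltnS leq_eqVlt => /predU1P[->|rm] [zy zyr].
  by apply: (IHe (z m)) => //; [rewrite -ye|move=> q qm; rewrite zy ?yx].
apply: IHx; exists r => //; split; last by rewrite -yx.
by move=> q qr; rewrite zy // yx // (ltn_trans qr).
Qed.

End LexicographicOrder.

Section SumOrder.
Local Open Scope order_scope.
Variable A : ordinal_type.

Definition lt_sum (x y : A + nat) : Prop :=
  match x, y with
  | inl i, inl j => i < j
  | inl _, inr _ => True
  | inr m, inr n => (m < n)%N
  | inr _, inl _ => False
  end.

Lemma lt_sum_trans x y z : lt_sum x y -> lt_sum y z -> lt_sum x z.
Proof.
by case: x y z => [x|x] [y|y] [z|z] //=; [exact: lt_trans|exact: ltn_trans].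
Qed.

Lemma lt_sum_wf : well_founded lt_sum.
Proof.
have accl i : Acc lt_sum (inl i).
  elim/(well_founded_ind (@ordinal_wf A)): i => i IH.
  by constructor=> -[j ji|n []]; exact (IH j ji).
case=> [i|n]; first exact (accl i).
elim/ltn_ind: n => n IH; constructor=> -[j _|k kn]; first exact (accl j).
exact (IH k kn).
Qed.

End SumOrder.

(* Along [parent], the intervals [[lo i, hi i]] of a connected component of their
   union form a tree, which [key] orders in post-order. *)
Section Intervals.
Local Open Scope order_scope.
Variables (A : ordinal_type) (d : Order.disp_t) (T : orderType d) (lo hi : A -> T).
Hypotheses (lo_homo : {homo lo : x y / x < y}) (hi_homo : {homo hi : x y / x < y})
  (lo_hi : forall i, lo i <= hi i).

Let lo_mono : {mono lo : x y / x <= y}. Proof. exact: le_mono. Qed.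
Let hi_mono : {mono hi : x y / x <= y}. Proof. exact: le_mono. Qed.

Lemma parent_subproof i : exists j, lo i <= hi j /\ forall k, lo i <= hi k -> j <= k.
Proof. by apply: ordinal_min; exists i. Qed.

Definition parent i : A := projT1 (cid (parent_subproof i)).

(** A Galois connection: every comparison of a lower with an upper end becomes a comparison of
    indices. *)
Lemma lo_le_hi i j : (lo i <= hi j) = (parent i <= j).
Proof.
rewrite /parent; case: cid => k [ik kmin] /=; apply/idP/idP; first exact: kmin.
by move=> kj; rewrite (le_trans ik) ?hi_mono.
Qed.

Lemma parent_le i : parent i <= i.
Proof. by rewrite -lo_le_hi. Qed.

Lemma parent_homo : {homo parent : i j / i <= j}.
Proof.
move=> i j ij; rewrite -lo_le_hi (@le_trans _ _ (lo j)) ?lo_mono //.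
by rewrite lo_le_hi.
Qed.

Lemma iter_parent_homo k : {homo iter k parent : i j / i <= j}.
Proof. by elim: k => [//|k IH] i j ij /=; apply/parent_homo/IH. Qed.

Lemma level_subproof i : exists k, parent (iter k parent i) == iter k parent i.
Proof.
elim/(well_founded_ind (@ordinal_wf A)): i => i IH.
have [pi|pi] := eqVneq (parent i) i; first by exists 0; apply/eqP.
have [|k kP] := IH (parent i); first by rewrite lt_neqAle pi parent_le.
by exists k.+1; rewrite iterSr.
Qed.

Definition level i : nat := ex_minn (level_subproof i).

(** Indexed by level, counted from the root; for [k] above [level i] the truncated subtraction
    returns [i]. *)
Definition ancestor i k : A := iter (level i - k) parent i.

Definition root i : A := ancestor i 0.

Lemma level0 i : (level i == 0) = (parent i == i).
Proof.
rewrite /level; case: ex_minnP => k kP kmin; apply/eqP/idP => [k0|].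
  by move: kP; rewrite k0.
by move=> pi; have := kmin 0; rewrite leqn0 => /(_ pi)/eqP.
Qed.

Lemma level_parent i : level (parent i) = (level i).-1.
Proof.
have [li|li] := posnP (level i).
  by rewrite li; move/eqP: (li); rewrite level0 => /eqP ->; rewrite li.
rewrite /level; case: ex_minnP => k kP kmin; case: ex_minnP => k' kP' kmin'.
have k'0 : (0 < k')%N.
  by case: k' kP' {kmin'} => // pi; move: li; rewrite lt0n level0 pi.
apply/eqP; rewrite eqn_leq; apply/andP; split.
  by apply: kmin; rewrite -iterSr prednK.
by rewrite -ltnS prednK //; apply: kmin'; rewrite iterSr.
Qed.

Lemma level_iter k i : level (iter k parent i) = (level i - k)%N.
Proof. by elim: k => [|k IH]; rewrite ?subn0 //= level_parent IH subnS. Qed.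

Lemma level_ancestor i k : (k <= level i)%N -> level (ancestor i k) = k.
Proof. by move=> ki; rewrite level_iter subKn. Qed.

Lemma ancestor_level i : ancestor i (level i) = i.
Proof. by rewrite /ancestor subnn. Qed.

Lemma parent_ancestor i k : (k < level i)%N ->
  parent (ancestor i k.+1) = ancestor i k.
Proof. by move=> ki; rewrite /ancestor -iterS -subSn // subSS. Qed.

Lemma ancestor_parent i k : (k < level i)%N ->
  ancestor (parent i) k = ancestor i k.
Proof.
rewrite /ancestor level_parent -iterSr; case: (level i) => // n.
by rewrite ltnS => kn; rewrite subSn.
Qed.

Lemma parent_root i : parent (root i) = root i.
Proof. by apply/eqP; rewrite -level0 level_ancestor. Qed.

Lemma iter_parent_root k i : (level i <= k)%N -> iter k parent i = root i.
Proof.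
move=> /subnK <-; rewrite iterD /root /ancestor subn0.
by elim: (k - level i)%N => //= n ->; have := parent_root i; rewrite /root /ancestor subn0.
Qed.

Lemma root_parent i : root (parent i) = root i.
Proof.
rewrite -(@iter_parent_root (level i) (parent i)) ?level_parent ?leq_pred //.
by rewrite -iterSr iter_parent_root.
Qed.

Lemma root_level0 i : level i = 0 -> root i = i.
Proof. by rewrite /root /ancestor => ->. Qed.

Lemma root_homo : {homo root : i j / i <= j}.
Proof.
move=> i j ij; pose k := maxn (level i) (level j).
rewrite -(@iter_parent_root k i) ?leq_maxl // -(@iter_parent_root k j) ?leq_maxr //.
exact: iter_parent_homo.
Qed.

Lemma root_lt_hi_lo i j : root i < root j -> hi i < lo j.
Proof.
rewrite !ltNge lo_le_hi; apply: contra => /root_homo.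
by rewrite root_parent.
Qed.

Lemma root_le_iter k i : root i <= iter k parent i.
Proof.
have [ki|/ltnW ik] := leqP (level i) k; first by rewrite iter_parent_root.
rewrite -(iter_parent_root (leqnn _)) -(subnK ik) iterD.
elim: (_ - _)%N => //= n; apply: le_trans; exact: parent_le.
Qed.

(** Iterating the monotone [parent] [level j] times takes [j] to the root, hence squeezes [i] onto
    it as well. *)
Lemma level_homo i j : root i = root j -> i <= j -> (level i <= level j)%N.
Proof.
move=> rij ij; rewrite -subn_eq0 -level_iter.
have -> : iter (level j) parent i = root i.
  apply/le_anti; rewrite root_le_iter andbT rij.
  by rewrite -(iter_parent_root (leqnn (level j))) iter_parent_homo.
by rewrite level_ancestor.
Qed.

Lemma level_lt i j : root i = root j -> (level i < level j)%N -> i < j.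
Proof.
by move=> rij; rewrite ltNge ltnNge; apply/contra/level_homo.
Qed.

Lemma level_le_lo_hi i j : root i = root j -> lo i < hi i ->
  (level i <= level j)%N -> lo i < hi j.
Proof.
move=> rij ii lij; have [ij|ji] := leP i j.
  by rewrite (lt_le_trans ii) ?hi_mono.
have /eqP lij' : level i == level j by rewrite eqn_leq lij level_homo ?ltW.
have [li|li] := posnP (level i).
  by move: ji; rewrite -(root_level0 li) rij root_level0 ?ltxx // -lij'.
apply: (@le_lt_trans _ _ (hi (parent i))); first by rewrite lo_le_hi.
apply/hi_homo/level_lt; first by rewrite root_parent.
by rewrite level_parent -lij' prednK.
Qed.

Lemma level_hi_lo i j : root i = root j -> ((level j).+1 < level i)%N -> hi j < lo i.
Proof.
move=> rij; rewrite ltNge lo_le_hi; apply: contraTN => pij; rewrite -leqNgt.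
have := level_homo _ pij; rewrite root_parent => /(_ rij).
by rewrite level_parent; case: (level i).
Qed.

(* A last child [x] with [lo x = hi (parent x)] must get the key of its parent. *)
Definition branch x : A + nat := if lo x == hi (parent x) then inr 0 else inl x.

(* [inr 0] is larger than every [inl x], so that a node comes after its subtree. *)
Definition branches i r : A + nat := if (r <= level i)%N then branch (ancestor i r) else inr 0.

Lemma branches_parent i r : (r < level i)%N -> branches (parent i) r = branches i r.
Proof.
move=> ri; rewrite /branches level_parent ancestor_parent // (ltnW ri).
by rewrite -ltnS (ltn_predK ri) ri.
Qed.

(** At the first level [r] where the ancestors differ they are siblings. The earlier one starts
    strictly before the end of their parent, so its [branch] is an [inl], below either possible
    value for the other. *)
Lemma branches_lt i j : root i = root j -> level i = level j -> i < j ->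
  exists r, [/\ (0 < r <= level i)%N,
    forall q, (q < r)%N -> branches i q = branches j q
    & lt_sum (branches i r) (branches j r)].
Proof.
move=> rij lij ij.
have ex : exists r, (r <= level i)%N && (ancestor i r != ancestor j r).
  by exists (level i); rewrite leqnn ancestor_level lij ancestor_level lt_eqF.
have [r /andP[ri rne] rmin] := ex_minnP ex.
have agree q : (q < r)%N -> ancestor i q = ancestor j q.
  move=> qr; apply/eqP; apply: contraT => ne.
  by move: (rmin q); rewrite ne (leq_trans (ltnW qr) ri) leqNgt qr => /(_ isT).
have r0 : (0 < r)%N.
  by rewrite lt0n; apply: contraNneq rne => ->; rewrite -!/(root _) rij.
exists r; split; first by rewrite r0.
  move=> q qr; have qi := leq_trans (ltnW qr) ri.
  by rewrite /branches qi -lij qi agree.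
have lt_anc : ancestor i r < ancestor j r.
  by rewrite lt_neqAle rne /= /ancestor -lij; apply/iter_parent_homo/ltW.
have par : parent (ancestor i r) = parent (ancestor j r).
  move: ri agree; case: (r) r0 => // q _ qi agree.
  by rewrite !parent_ancestor -?lij // agree.
rewrite /branches -lij ri {1}/branch lt_eqF.
  by rewrite /branch; case: ifP.
apply: lt_le_trans (lo_homo lt_anc) _.
by rewrite par lo_le_hi.
Qed.

(** The root settles level 0, so the slot of [branches i 0] is free for the column, which thereby
    takes precedence over the post-order. *)
Definition key (c : nat) i (r : nat) : A + nat :=
  match r with
  | 0 => inl (root i)
  | 1 => inr c
  | q.+1 => branches i q
  end.

Variable m : nat.
Hypothesis level_lt_m : forall i, (level i < m)%N.

Notation klt := (ltlex (@lt_sum A) m.+1).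

Let m_gt0 (i : A) : (0 < m)%N.
Proof. exact: leq_trans (level_lt_m i). Qed.

Lemma key_lt_root c c' i j : root i < root j -> klt (key c i) (key c' j).
Proof. by move=> rij; exists 0. Qed.

Lemma key_lt_col c c' i j : root i = root j -> (c < c')%N -> klt (key c i) (key c' j).
Proof.
by move=> rij cc'; exists 1; [rewrite ltnS (m_gt0 i)|split=> [[]//=|//]; rewrite rij].
Qed.

Lemma key_lt_branches c i j r : root i = root j -> (0 < r < m)%N ->
  (forall q, (q < r)%N -> branches i q = branches j q) ->
  lt_sum (branches i r) (branches j r) -> klt (key c i) (key c j).
Proof.
move=> rij /andP[r0 rm] agree ltr; exists r.+1; first by rewrite ltnS.
split; last by case: r r0 {rm agree} ltr.
by case=> [|[|q]] //=; [rewrite rij|rewrite ltnS => /agree].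
Qed.

Lemma key_homo (c : A -> nat) i j : i < j ->
  (root i = root j -> level i = level j -> c i = c j) ->
  (root i = root j -> (level i < level j)%N -> (c i < c j)%N) ->
  klt (key (c i) i) (key (c j) j).
Proof.
move=> ij ceq clt; have := root_homo (ltW ij).
rewrite le_eqVlt => /predU1P[rij|]; last exact: key_lt_root.
have := level_homo rij (ltW ij); rewrite leq_eqVlt => /predU1P[lij|lij].
  have [r [/andP[r0 ri] agree ltr]] := branches_lt rij lij ij.
  rewrite ceq //; apply: (key_lt_branches _ rij _ agree ltr).
  by rewrite r0 (leq_ltn_trans ri).
by apply: key_lt_col => //; exact: clt.
Qed.

Definition same_cmp (x y : T) (w w' : nat -> A + nat) : Prop :=
  [\/ x < y /\ klt w w', x = y /\ w = w' | y < x /\ klt w' w].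

Lemma same_cmp_sym x y w w' : same_cmp x y w w' -> same_cmp y x w' w.
Proof. by case=> -[h1 h2]; [apply: Or33|apply: Or32|apply: Or31]. Qed.

(** By [lo_le_hi] it suffices to compare [parent i] with [j]. If they differ, the keys split at a
    level that [i] shares with its parent. If they coincide, [branch i] meets [inr 0] at [level i]:
    it is smaller, or equal when [lo i] is the upper end of the parent. *)
Lemma key_cmp_child c i j : root i = root j -> level i = (level j).+1 ->
  same_cmp (lo i) (hi j) (key c i) (key c j).
Proof.
move=> rij lij; have pl : level (parent i) = level j by rewrite level_parent lij.
have jm : ((level j).+1 < m)%N by rewrite -lij.
have lt_i : (level j < level i)%N by rewrite lij.
have prij : root (parent i) = root j by rewrite root_parent.
have [pij|pij|pij] := ltgtP (parent i) j.
- have [r [/andP[r0 ri] agree ltr]] := branches_lt prij pl pij.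
  have rlt : (r < level i)%N by rewrite lij ltnS -pl.
  apply: Or31; split; first by rewrite (@le_lt_trans _ _ (hi (parent i))) ?lo_le_hi ?hi_homo.
  apply: (key_lt_branches _ rij (r := r)); first by rewrite r0 (ltn_trans rlt).
    by move=> q qr; rewrite -agree // branches_parent // (ltn_trans qr).
  by rewrite -branches_parent.
- have [r [/andP[r0 ri] agree ltr]] := branches_lt (esym prij) (esym pl) pij.
  have rlt : (r < level i)%N by rewrite lij ltnS.
  apply: Or33; split; first by rewrite ltNge lo_le_hi -ltNge.
  apply: (key_lt_branches _ (esym rij) (r := r)); first by rewrite r0 (ltn_trans rlt).
    by move=> q qr; rewrite agree // branches_parent // (ltn_trans qr).
  by rewrite -[branches i r]branches_parent.
- have agree q : (q < level i)%N -> branches i q = branches j q.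
    by move=> qi; rewrite -branches_parent // pij.
  have keyi : branches i (level i) = branch i by rewrite /branches leqnn ancestor_level.
  have keyj q : (level i <= q)%N -> branches j q = inr 0.
    by rewrite /branches lij; case: leqP => // h1 h2; move: (leq_trans h2 h1); rewrite ltnn.
  have : lo i <= hi j by rewrite lo_le_hi pij.
  rewrite le_eqVlt => /predU1P[tight|lt_lo].
    apply: Or32; split=> //; apply/funext => -[|[|q]] //=; first by rewrite rij.
    have [qi|qi|qi] := ltngtP q.+1 (level i); first exact: agree.
      by rewrite keyj ?(ltnW qi) // /branches leqNgt qi.
    by rewrite qi keyi keyj // /branch pij tight eqxx.
  apply: Or31; split=> //; apply: (key_lt_branches _ rij (r := level i)) => //.
    by rewrite lij.
  by rewrite keyi keyj // /branch pij (lt_eqF lt_lo).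
Qed.

(** Columns decide unless [level i] exceeds [level j] by exactly one; then they agree and the
    post-order decides. *)
Lemma key_cmp c c' i j : root i = root j -> lo i < hi i ->
  ((level i <= level j)%N -> (c < c')%N) ->
  (level i = (level j).+1 -> c = c') ->
  (((level j).+1 < level i)%N -> (c' < c)%N) ->
  same_cmp (lo i) (hi j) (key c i) (key c' j).
Proof.
move=> rij ii h1 h2 h3; have [lij|lji] := leqP (level i) (level j).
  by apply: Or31; split; [exact: level_le_lo_hi|apply: key_lt_col => //; exact: h1].
move: lji; rewrite leq_eqVlt => /predU1P[lij|lij].
  by rewrite h2 //; exact: key_cmp_child.
by apply: Or33; split; [exact: level_hi_lo|apply: key_lt_col => //; exact: h3].
Qed.

End Intervals.

(** * Cardinal arithmetic *)

Section Cardinality.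
Local Open Scope classical_set_scope.
Local Open Scope card_scope.

Lemma injective_card_le (T U : Type) (f : T -> U) :
  injective f -> [set: T] #<= [set: U].
Proof.
move=> injf; apply/inj_card_le/unsquash.
by apply/injfunPex; exists f => // x y _ _; exact: injf.
Qed.

Lemma card_le_injective (T U : Type) :
  [set: T] #<= [set: U] -> exists f : T -> U, injective f.
Proof.
move=> /card_leP[g].
exists (fun x => val (g (exist _ x (mem_set I)))) => x y /val_inj/(inj (mem_set I) (mem_set I)).
by case.
Qed.

(** The case [f = g] makes each sequence injective. *)
Definition disjoint_sequences (T : Type) (S : set (nat -> T)) : Prop :=
  forall f g, S f -> S g -> forall k l, f k = g l -> f = g /\ k = l.

(** A maximal family of disjoint sequences covers all but finitely many points. Covered points are
    coded by a sequence and a position, the others by a position along [f0], and the factor [nat] is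
    absorbed into the position. *)
Lemma infinite_card_prod_nat (T : Type) :
  infinite_set [set: T] -> [set: T * nat] #<= [set: T].
Proof.
move=> Tinf.
have [F FP Ftot|S [Sdisj Smax]] := @Zorn_bigcup _ (@disjoint_sequences T).
  move=> f g [X FX Xf] [Y FY Yg]; have [XY|YX] := Ftot X Y FX FY.
    exact: (FP Y FY f g (XY _ Xf) Yg).
  exact: (FP X FX f g Xf (YX _ Yg)).
pose U := [set x | exists2 f, S f & range f x].
have Cfin : finite_set (~` U).
  apply: contrapT => /infiniteP/card_leP[g].
  pose h n := val (g (exist _ n (mem_set I))).
  have hU n : ~ U (h n) by exact: (set_mem (valP (g _))).
  have hinj : injective h.
    by move=> x y /val_inj/(inj (mem_set I) (mem_set I)); case.
  apply: (Smax (S `|` [set h])).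
    split; first by move=> f Sf; left.
    move=> SU; apply: (hU 0); exists h; last by exists 0.
    by apply: SU; right.
  move=> f1 f2 [Sf1|->] [Sf2|->] k l.
  - exact: Sdisj.
  - by move=> e; case: (hU l); exists f1 => //; exists k.
  - by move=> e; case: (hU k); exists f2 => //; exists l.
  - by move=> /hinj.
have [f0 Sf0] : exists f, S f.
  apply: contrapT => nS; apply: Tinf; apply: sub_finite_set Cfin => x _ [f Sf _].
  by apply: nS; exists f.
have /countable_injP[c cinj] := finite_set_countable Cfin.
have ex x : exists fc : (nat -> T) * (bool * nat), S fc.1 /\
    if fc.2.1 then fc.1 fc.2.2 = x else (~ U x /\ c x = fc.2.2).
  have [[f Sf [k _ fk]]|nU] := pselect (U x); first by exists (f, (true, k)).
  by exists (f0, (false, c x)).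
pose code x := projT1 (cid (ex x)).
have codeP x : S (code x).1 /\ if (code x).2.1 then (code x).1 (code x).2.2 = x
    else (~ U x /\ c x = (code x).2.2) by exact: (projT2 (cid (ex x))).
apply: (@injective_card_le _ _ (fun xn => (code xn.1).1 (pickle ((code xn.1).2, xn.2)))).
move=> [x n] [y k] /=; have [Sx xP] := codeP x; have [Sy yP] := codeP y.
move=> /(Sdisj _ _ Sx Sy)[e1 /(pcan_inj pickleK)[e2 <-]].
congr pair; move: xP yP; rewrite e1 e2; case: ifP => _; first by move=> <-.
by move=> [Ux cx] [Uy cy]; apply: cinj; rewrite ?inE // cx.
Qed.

Lemma not_card_le_countable_prod (K L V M : Type) :
  is_succ_card K L -> [set: M] #= [set: L + nat] -> countable [set: V] ->
  (finite_set [set: K] -> finite_set [set: V]) ->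
  ~ ([set: M] #<= [set: V * K]).
Proof.
move=> [[_ nLK] _] eqM Vcount Vfin leM.
have sumVK : [set: L + nat] #<= [set: V * K].
  by apply: card_le_trans leM; move: eqM; rewrite card_eq_le => /andP[].
have [Kfin|Kinf] := pselect (finite_set [set: K]).
  have /infiniteP : [set: nat] #<= [set: V * K].
    by apply: card_le_trans sumVK; apply: (@injective_card_le _ _ inr) => x y [].
  by apply; rewrite -setXTT; apply: finite_setX => //; exact: Vfin.
apply: nLK; apply: (@card_le_trans _ _ _ [set: L + nat]).
  by apply: (@injective_card_le _ _ inl) => x y [].
apply: card_le_trans sumVK _; apply: card_le_trans (infinite_card_prod_nat Kinf).
have [g ginj] := card_le_injective Vcount.
by apply: (@injective_card_le _ _ (fun vk => (vk.2, g vk.1))) => -[v k] [w l] [-> /ginj ->].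
Qed.

(** A function is coded by its graph, a set of naturals via [pickle], and a singleton climbs to the
    second power set. *)
Lemma beth2_sequences : [set: nat -> nat] #<= [set: beth 2 nat].
Proof.
pose graph (g : nat -> nat) : set nat := [set pickle (n, g n) | n in [set: nat]].
apply: (@injective_card_le _ _ (fun g => [set graph g])) => g h.
move=> /(congr1 (fun X => X (graph g))) /=; rewrite propeqE => -[/(_ erefl) + _].
move=> gh; apply/funext => n.
have : graph h (pickle (n, g n)) by rewrite -gh; exists n.
by move=> [k _ /(pcan_inj pickleK)[-> ->]].
Qed.

End Cardinality.

(** * Embedding a small well-founded relation in an ordinal *)

Section Embedding.
Local Open Scope order_scope.
Local Open Scope classical_set_scope.
Local Open Scope card_scope.

(** By recursion [h x] is the least value not taken at a predecessor in [D]; one exists because [D]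
    is too small to exhaust [mu]. By transitivity a value free at [y] is free at each predecessor
    [x] of [y], so minimality gives [h x <= h y]. *)
Lemma wf_embedding (K : Type) (ltK : K -> K -> Prop) (D : set K) (mu : ordinal_type) :
  well_founded ltK -> (forall x y z, ltK x y -> ltK y z -> ltK x z) ->
  ~ ([set: mu] #<= D) ->
  exists h : K -> mu, forall x y, D x -> ltK x y -> h x < h y.
Proof.
move=> wfK trK nmuD.
have [y0 _] : exists y : mu, True.
  apply: contrapT => nmu; apply: nmuD.
  have -> : [set: mu] = set0 by rewrite -subset0 => y _; apply: nmu; exists y.
  exact: card_ge0.
pose new x (rec : forall x', ltK x' x -> mu) y := forall x' (l : ltK x' x), D x' -> rec x' l <> y.
pose least (P : mu -> Prop) := [set y | P y /\ forall z, P z -> y <= z].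
pose step x rec := xget y0 (least (new x rec)).
pose h := Fix wfK (fun=> mu : Type) step.
have hE x : h x = step x (fun y _ => h y).
  apply: (Fix_eq wfK (fun=> mu : Type) step) => {}x f g fg; congr (step x).
  by apply: functional_extensionality_dep => y; apply/funext.
have hP x : new x (fun y _ => h y) (h x) /\ forall z, new x (fun y _ => h y) z -> h x <= z.
  have [|y yP] := @ordinal_min mu (new x (fun y _ => h y)).
    apply: contrapT => nnew; apply: nmuD.
    apply: (@card_le_trans _ _ _ (h @` D)); last exact: card_image_le.
    apply: subset_card_le => y _; apply: contrapT => nDy.
    by apply: nnew; exists y => x' l Dx' e; apply: nDy; exists x'.
  by rewrite hE; exact: (@xgetI _ y0 (least (new x (fun y _ => h y))) y yP).
exists h => x y Dx xy.
have [newy _] := hP y; have [_ minx] := hP x.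
rewrite lt_neqAle; apply/andP; split; first by apply/eqP; exact: newy.
by apply: minx => z zx Dz; apply: newy => //; exact: trK xy.
Qed.

End Embedding.

(** * Order types of pairs of sequences *)

Section SameOtp.
Local Open Scope order_scope.
Local Open Scope classical_set_scope.
Variables (d d' : Order.disp_t) (A : orderType d) (T : orderType d').
Implicit Types a b c e : incr_fun A T.

Lemma incr_fun_le a : {mono a : i j / i <= j}.
Proof. exact/le_mono/incr_homo. Qed.

Lemma same_otp_le c e a b : same_otp c e a b ->
  forall i j, (c i <= e j) = (a i <= b j) /\ (e j <= c i) = (b j <= a i).
Proof.
move=> [f [fc fe _ fmono]] i j; rewrite -fc -fe.
by rewrite !fmono ?inE; [| right| left| left| right]; [split| exists j| exists i| exists i| exists j].
Qed.

(** Comparisons within one sequence agree automatically, all four being increasing; only those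
    across are at stake. *)
Lemma le_same_otp c e a b :
  (forall i j, (c i <= e j) = (a i <= b j) /\ (e j <= c i) = (b j <= a i)) ->
  same_otp c e a b.
Proof.
move=> H.
have Hc i j : (c i == c j) = (a i == a j) by rewrite !eq_le !incr_fun_le.
have He i j : (e i == e j) = (b i == b j) by rewrite !eq_le !incr_fun_le.
have Hce i j : (c i == e j) = (a i == b j) by rewrite !eq_le !(proj1 (H _ _)) !(proj2 (H _ _)).
pose R x y := (exists2 i, c i = x & a i = y) \/ (exists2 i, e i = x & b i = y).
pose f x := xget x (R x).
have fc i : f (c i) = a i.
  apply: (@xget_subset1 _ (c i) (R (c i))); first by left; exists i.
  have u y : R (c i) y -> y = a i.
    case=> -[j cj <-]; apply/eqP; first by rewrite -Hc cj.
    by rewrite eq_sym -Hce cj.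
  by move=> y z /u -> /u ->.
have fe i : f (e i) = b i.
  apply: (@xget_subset1 _ (e i) (R (e i))); first by right; exists i.
  have u y : R (e i) y -> y = b i.
    case=> -[j cj <-]; apply/eqP; first by rewrite -Hce cj.
    by rewrite -He cj.
  by move=> y z /u -> /u ->.
have fmono : {in range c `|` range e &, {mono f : x y / x <= y}}.
  move=> x y; rewrite !inE => -[[i _ <-]|[i _ <-]] [[j _ <-]|[j _ <-]]; rewrite ?fc ?fe.
  - by rewrite !incr_fun_le.
  - by rewrite (proj1 (H _ _)).
  - by rewrite (proj2 (H _ _)).
  - by rewrite !incr_fun_le.
exists f; split=> //; split.
- by move=> x [[i _ <-]|[i _ <-]]; [left|right]; exists i; rewrite ?fc ?fe.
- by move=> x y xD yD fxy; apply/le_anti; rewrite -[x <= y]fmono // -[y <= x]fmono // fxy lexx.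
- by move=> x [[i _ <-]|[i _ <-]]; [exists (c i)|exists (e i)] => //; [left|right]; exists i.
Qed.

Lemma same_otp_swap c e a b : same_otp c e a b -> same_otp e c b a.
Proof.
by move=> /same_otp_le H; apply: le_same_otp => i j; have [] := H j i.
Qed.

End SameOtp.

(** * Colourings from unbounded levels *)

Section Colouring.
Local Open Scope order_scope.
Variables (d : Order.disp_t) (T : orderType d).

Definition eventually (P : nat -> Prop) : Prop := exists N, forall n, (N <= n)%N -> P n.

Lemma eventually_and (P Q R : nat -> Prop) :
  (forall n, P n -> Q n -> R n) -> eventually P -> eventually Q -> eventually R.
Proof.
move=> PQR [N PN] [M QM]; exists (maxn N M) => n; rewrite geq_max => /andP[/PN Pn /QM Qn].
exact: PQR.
Qed.

(* The sequences [x v k], ordered by eventual domination, increase with [k] and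
   neighbours interleave. Neighbours are hence cofinal in one another, so a
   component has a common cofinal sequence; the colour of [v] records where
   each [x v k] falls in that sequence. *)
Lemma interleaving_colouring (V : Type) (R : V -> V -> Prop) (x : V -> nat -> nat -> T) :
  (forall v k, eventually (fun n => x v k n < x v k.+1 n)) ->
  (forall v w, R v w -> forall k,
     eventually (fun n => x v k.+1 n <= x w k n) /\ eventually (fun n => x w k n < x v k.+2 n)) ->
  exists g : V -> nat -> nat, forall v w, R v w -> g v <> g w.
Proof.
move=> xincr xR.
pose cof v w := forall k, exists l, eventually (fun n => x v k n <= x w l n).
have cof_refl v : cof v v by move=> k; exists k; exists 0.
have cof_trans u v w : cof u v -> cof v w -> cof u w.
  move=> uv vw k; have [l ukl] := uv k; have [q vlq] := vw l; exists q.
  by apply: eventually_and ukl vlq => n; exact: le_trans.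
pose cls v := [set w | cof v w /\ cof w v]%classic.
have clsE v w : cof v w -> cof w v -> cls v = cls w.
  move=> vw wv; apply/predeqP => u; split=> -[h1 h2]; split.
  - exact: cof_trans h1.
  - exact: cof_trans vw.
  - exact: cof_trans h1.
  - exact: cof_trans wv.
have [rep repP] : exists rep : set V -> option V, forall v, exists2 w, rep (cls v) = Some w & cls v w.
  exists (fun X => if pselect (exists w, X w) is left e then Some (projT1 (cid e)) else None).
  move=> v; case: pselect => [e|[]]; last by exists v.
  by exists (projT1 (cid e)) => //; exact: (projT2 (cid e)).
have pos v k : exists l, `[< forall w, rep (cls v) = Some w -> eventually (fun n => x v k n < x w l n) >].
  have [w ew [vw wv]] := repP v; have [l hl] := vw k.+1; exists l.
  apply/asboolP => u; rewrite ew => -[<-].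
  by apply: eventually_and (xincr v k) hl => n; exact: lt_le_trans.
exists (fun v k => ex_minn (pos v k)) => v w vw e.
have Rcof : cls v = cls w.
  apply: clsE => k.
    exists k; have [h _] := xR v w vw k.
    by apply: eventually_and (xincr v k) h => n h1 h2; apply: le_trans h2; exact: ltW.
  exists k.+2; have [_ [N h]] := xR v w vw k.
  by exists N => n /h/ltW.
have [u eu [vu uv]] := repP v.
pose g k := ex_minn (pos v k).
have gP k : eventually (fun n => x v k n < x u (g k) n).
  by rewrite /g; case: ex_minnP => l /asboolP h _; exact: h.
(* The colours of [v] and [w] agree, so [x v k.+1], eventually at most [x w k], lies below position
   [g k] as well: positions never increase. *)
have gS k : (g k.+1 <= g k)%N.
  rewrite {1}/g; case: ex_minnP => l _; apply; apply/asboolP => u' eu'.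
  have -> : g k = ex_minn (pos w k) by exact: (congr1 (fun f => f k) e).
  case: ex_minnP => l' /asboolP + _; rewrite -Rcof => /(_ _ eu') h.
  have [h' _] := xR v w vw k.
  by apply: eventually_and h' h => n; exact: le_lt_trans.
have g0 k : (g k <= g 0)%N by elim: k => // k IH; exact: leq_trans IH.
have umono l l' : (l <= l')%N -> eventually (fun n => x u l n <= x u l' n).
  move=> /subnK <-; elim: (_ - _)%N => [|q IH]; first by exists 0.
  by apply: eventually_and IH (xincr u (q + l)%N) => n h1 h2; apply: le_trans h1 _; exact: ltW.
(* Some [x v k] dominates [x u (g 0)], yet lies below position [g k <= g 0]. *)
have [k hk] := uv (g 0).
have h1 := eventually_and (fun n (h1 : x v k n < _) h2 => lt_le_trans h1 h2) (gP k) (umono _ _ (g0 k)).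
have [N hN] := eventually_and (fun n (h1 : x u (g 0) n <= x v k n) h2 => le_lt_trans h1 h2) hk h1.
by have := hN N (leqnn N); rewrite ltxx.
Qed.

End Colouring.

Section DeepTrees.
Local Open Scope order_scope.
Variables (A : ordinal_type) (d : Order.disp_t) (T : orderType d) (lo hi : A -> T).
Hypotheses (lo_homo : {homo lo : x y / x < y}) (hi_homo : {homo hi : x y / x < y})
  (lo_hi : forall i, lo i <= hi i).
Variables (a b : incr_fun A T) (i_ : nat -> A).

Notation level := (level hi_homo lo_hi).
Notation root := (root hi_homo lo_hi).
Notation anc := (ancestor hi_homo lo_hi).

Hypotheses (deep : forall n, (n <= level (i_ n))%N)
  (loa : forall n k, lo (anc (i_ n) k) = a (anc (i_ n) k))
  (hib : forall n k, hi (anc (i_ n) k) = b (anc (i_ n) k)).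

Lemma root_ancestor i k : root (anc i k) = root i.
Proof.
rewrite /ancestor; elim: (_ - _)%N => //= n.
by rewrite root_parent.
Qed.

Lemma ancestor_lt i k l : (k < l <= level i)%N -> anc i k < anc i l.
Proof.
move=> /andP[kl li]; apply: (level_lt lo_homo (hi_homo := hi_homo) (lo_hi := lo_hi)).
  by rewrite !root_ancestor.
by rewrite !level_ancestor // ltnW // (leq_trans kl).
Qed.

(** Along a branch, [lo] at level [k.+1] is at most [hi] at level [k], which is less than [lo] at
    level [k.+2]. Equality of order types carries this over to [v] and [w], for all [n] whose branch
    is long enough. *)
Lemma deep_trees_colouring : exists g : incr_fun A T -> nat -> nat,
  forall v w, same_otp v w a b -> g v <> g w.
Proof.
apply: (@interleaving_colouring _ T (incr_fun A T) (fun v w => same_otp v w a b)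
  (fun v k n => v (anc (i_ n) k))).
  move=> v k; exists k.+1 => n kn; apply/incr_homo/ancestor_lt.
  by rewrite ltnSn (leq_trans kn).
move=> v w /same_otp_le vw k; split.
  exists k.+1 => n kn; rewrite (proj1 (vw _ _)) -loa -hib (lo_le_hi hi_homo lo_hi).
  by rewrite parent_ancestor // (leq_trans kn).
exists k.+2 => n kn; rewrite ltNge (proj1 (vw _ _)) -ltNge -loa -hib.
have kl := leq_trans kn (deep n).
apply: (level_hi_lo lo_homo (hi_homo := hi_homo) (lo_hi := lo_hi)).
  by rewrite !root_ancestor.
by rewrite !level_ancestor // ltnW // ltnW.
Qed.

End DeepTrees.

(** * The trees of two sequences and their copies *)

Section Pair.
Local Open Scope order_scope.
Variables (A : ordinal_type) (d : Order.disp_t) (T : orderType d).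
Variables a b : incr_fun A T.

Definition pair_lo i := Order.min (a i) (b i).
Definition pair_hi i := Order.max (a i) (b i).

Lemma pair_lo_homo : {homo pair_lo : i j / i < j}.
Proof.
by move=> i j ij; rewrite lt_min !gt_min !incr_homo // orbT.
Qed.

Lemma pair_hi_homo : {homo pair_hi : i j / i < j}.
Proof.
by move=> i j ij; rewrite gt_max !lt_max !incr_homo // orbT.
Qed.

Lemma pair_lo_hi i : pair_lo i <= pair_hi i.
Proof. by rewrite ge_min le_max lexx. Qed.

Notation level := (level pair_hi_homo pair_lo_hi).
Notation root := (root pair_hi_homo pair_lo_hi).
Notation anc := (ancestor pair_hi_homo pair_lo_hi).
Notation par := (parent pair_lo_hi).

Variant pair_spec i : T -> T -> bool -> bool -> Prop :=
  | PairUp of a i < b i : pair_spec i (a i) (b i) true false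
  | PairFix of a i = b i : pair_spec i (a i) (a i) false false
  | PairDown of b i < a i : pair_spec i (b i) (a i) false true.

Lemma pairP i : pair_spec i (pair_lo i) (pair_hi i) (a i < b i) (b i < a i).
Proof.
rewrite /pair_lo /pair_hi; case: (ltgtP (a i) (b i)) => h.
- exact: PairUp.
- exact: PairDown.
- exact: PairFix.
Qed.

(** If the directions differed, [pair_lo i] and [pair_hi (par i)] would be values of the same
    increasing sequence, and [pair_lo i <= pair_hi (par i)] would contradict [par i < i]. *)
Lemma parent_dir i : (a (par i) < b (par i)) = (a i < b i) /\
  (b (par i) < a (par i)) = (b i < a i).
Proof.
have [ppi|npi] := eqVneq (par i) i; first by rewrite ppi.
have ltp : par i < i by rewrite lt_neqAle npi (parent_le pair_hi_homo).
have : pair_lo i <= pair_hi (par i) by rewrite (lo_le_hi pair_hi_homo pair_lo_hi).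
have la := incr_homo a ltp; have lb := incr_homo b ltp.
case: (pairP i) => hi; case: (pairP (par i)) => hp // /le_lt_trans h.
- by have := h _ la; rewrite ltxx.
- by have := h _ la; rewrite ltxx.
- by move: (h _ lb); rewrite hi ltxx.
- by have := h _ la; rewrite ltxx.
- by have := h _ lb; rewrite ltxx.
- by move: h; rewrite hp => /(_ _ lb); rewrite ltxx.
Qed.

Lemma ancestor_dir i k : (a (anc i k) < b (anc i k)) = (a i < b i) /\
  (b (anc i k) < a (anc i k)) = (b i < a i).
Proof.
rewrite /ancestor; elim: (_ - _)%N => //= n [<- <-]; exact: parent_dir.
Qed.

Lemma fixed_root i : a i = b i -> root i = i /\ level i = 0.
Proof.
move=> ab.
suff : par i == i.
  by rewrite -(level0 pair_hi_homo) => /eqP li; rewrite (root_level0 li).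
rewrite eq_le (parent_le pair_hi_homo) /= leNgt; apply/negP => ltp.
have : pair_lo i <= pair_hi (par i) by rewrite (lo_le_hi pair_hi_homo pair_lo_hi).
have la := incr_homo a ltp; have lb := incr_homo b ltp.
by rewrite /pair_lo -ab minxx le_max !leNgt la /= ab lb.
Qed.

Lemma unbounded_level_colouring :
  (forall n, exists i, (n <= level i)%N /\ a i < b i) \/
  (forall n, exists i, (n <= level i)%N /\ b i < a i) ->
  exists g : incr_fun A T -> nat -> nat, forall v w, same_otp v w a b -> g v <> g w.
Proof.
case=> H; pose i_ n := projT1 (cid (H n)).
  have iP n := projT2 (cid (H n)).
  apply: (deep_trees_colouring pair_lo_homo (hi_homo := pair_hi_homo)
    (lo_hi := pair_lo_hi) (i_ := i_)) => [n|n k|n k]; first by have [] := iP n.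
    by case: pairP (ancestor_dir (i_ n) k) (proj2 (iP n)) => _ [] // <-.
  by case: pairP (ancestor_dir (i_ n) k) (proj2 (iP n)) => _ [] // <-.
have iP n := projT2 (cid (H n)).
have [|n k|n k|g gP] := deep_trees_colouring pair_lo_homo (hi_homo := pair_hi_homo)
    (lo_hi := pair_lo_hi) (i_ := i_) (a := b) (b := a).
- by move=> n; have [] := iP n.
- by case: pairP (ancestor_dir (i_ n) k) (proj2 (iP n)) => _ [] // _ <-.
- by case: pairP (ancestor_dir (i_ n) k) (proj2 (iP n)) => _ [] // _ <-.
by exists g => v w /same_otp_swap/gP/nesym.
Qed.

Section Shift.
Variable m : nat.
Hypothesis level_le_m : forall i, (level i <= m)%N.

Let level_lt_m i : (level i < m.+1)%N. Proof. exact: level_le_m. Qed.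

Definition increasing_upto (s : nat -> nat) := forall k l, (k < l <= m)%N -> (s k < s l)%N.

(** When [m = 0] the shift equations are vacuous, and the last clause orients the edge. *)
Definition shift_arrow (s t : nat -> nat) := [/\ increasing_upto s, increasing_upto t,
  forall k, (k < m)%N -> s k.+1 = t k & forall k, (k <= m)%N -> (s k < t k)%N].

Variable N : nat.
Definition bounded_upto (s : nat -> nat) := forall k, (k <= m)%N -> (s k <= N)%N.

(* Reversing [s] turns a shift into a shift in the opposite direction, as needed
   where [b i < a i]. *)
Definition column (s : nat -> nat) i : nat :=
  if a i < b i then s (level i)
  else if b i < a i then (N - s (m - level i))%N else 0.

Definition copy s i := key pair_hi_homo pair_lo_hi (column s i) i.

Notation klt := (ltlex (@lt_sum A) m.+2).

Lemma same_root_dir i j : root i = root j -> (a i < b i) = (a j < b j) /\ (b i < a i) = (b j < a j).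
Proof.
move=> rij; have [<- <-] := ancestor_dir i 0; have [<- <-] := ancestor_dir j 0.
by rewrite -!/(root _) rij.
Qed.

Lemma incr_le s k l : increasing_upto s -> (k <= l <= m)%N -> (s k <= s l)%N.
Proof.
move=> sincr /andP[]; rewrite leq_eqVlt => /predU1P[->//|kl] lm.
by apply/ltnW/sincr; rewrite kl.
Qed.

Lemma copy_homo s i j : increasing_upto s -> bounded_upto s -> i < j ->
  klt (copy s i) (copy s j).
Proof.
move=> sincr sN ij; apply: (key_homo pair_lo_homo level_lt_m ij) => rij lij.
  by rewrite /column lij; have [-> ->] := same_root_dir rij.
rewrite /column; have [-> ->] := same_root_dir rij.
have := level_le_m j => jm.
have [_|fj] := boolP (a j < b j); first by apply: sincr; rewrite lij.
have [_|fj'] := boolP (b j < a j).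
  have h1 : (s (m - level j) < s (m - level i))%N by apply: sincr; lia.
  have := sN (m - level i)%N (leq_subr _ _); lia.
have [_ lj] : root j = j /\ level j = 0.
  by apply: fixed_root; apply/le_anti; rewrite !leNgt fj fj'.
by move: lij; rewrite lj.
Qed.

Lemma copy_cmp s t i j : shift_arrow s t -> bounded_upto s -> bounded_upto t ->
  same_cmp m.+1 (a i) (b j) (copy s i) (copy t j).
Proof.
move=> [sincr tincr st s_lt_t] sN tN.
(* [shift1], [st] and [shift3] supply the column conditions of [key_cmp] for level differences at
   most 0, exactly 1 and at least 2. *)
have shift1 k l : (k <= l <= m)%N -> (s k < t l)%N.
  move=> klm; have := incr_le tincr klm; have := s_lt_t k; lia.
have shift3 k l : (l.+1 < k <= m)%N -> (t l < s k)%N.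
  by move=> klm; rewrite -st; [apply: sincr|]; lia.
have [im jm] := (level_le_m i, level_le_m j).
have loa x : pair_lo x <= a x by rewrite ge_min lexx.
have lob x : pair_lo x <= b x by rewrite ge_min lexx orbT.
have hia x : a x <= pair_hi x by rewrite le_max lexx.
have hib x : b x <= pair_hi x by rewrite le_max lexx orbT.
have [rij|rij|rij] := ltgtP (root i) (root j).
- apply: Or31; split; last exact: key_lt_root.
  by rewrite (le_lt_trans (hia i)) // (lt_le_trans _ (lob j)) // (root_lt_hi_lo pair_lo_homo rij).
- apply: Or33; split; last exact: key_lt_root.
  by rewrite (le_lt_trans (hib j)) // (lt_le_trans _ (loa i)) // (root_lt_hi_lo pair_lo_homo rij).
have [up dn] := same_root_dir rij.
have [ui|ui] := boolP (a i < b i).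
  have uj : a j < b j by rewrite -up.
  have -> : a i = pair_lo i by rewrite /pair_lo min_l // ltW.
  have -> : b j = pair_hi j by rewrite /pair_hi max_r // ltW.
  apply: (key_cmp pair_lo_homo level_lt_m rij); rewrite /column ?ui ?uj.
  - by rewrite /pair_lo /pair_hi (min_l (ltW ui)) (max_r (ltW ui)).
  - by move=> lij; apply: shift1; rewrite lij.
  - by move=> lij; rewrite lij st //; lia.
  - by move=> lij; apply: shift3; rewrite lij.
have [di|di] := boolP (b i < a i).
  have dj : b j < a j by rewrite -dn.
  have -> : a i = pair_hi i by rewrite /pair_hi max_l // ltW.
  have -> : b j = pair_lo j by rewrite /pair_lo min_r // ltW.
  have nuj : (a j < b j) = false by rewrite ltNge ltW.
  (* Now [a] gives the upper ends, so [s] and [t] exchange roles; the reversal in [column] restores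
     the inequalities. *)
  apply: same_cmp_sym.
  apply: (key_cmp pair_lo_homo level_lt_m (esym rij)); rewrite /column ?(negbTE ui) ?nuj ?di ?dj.
  - by rewrite /pair_lo /pair_hi (min_r (ltW dj)) (max_l (ltW dj)).
  - move=> lij; have := shift1 (m - level i)%N (m - level j)%N.
    have := tN (m - level j)%N; lia.
  - move=> lij; have := st (m - level j)%N.
    have -> : (m - level j).+1 = (m - level i)%N by lia.
    by move=> ->; lia.
  - move=> lij; have := shift3 (m - level i)%N (m - level j)%N.
    have := sN (m - level i)%N; lia.
have fi : a i = b i by apply/le_anti; rewrite !leNgt ui di.
have fj : a j = b j by apply/le_anti; rewrite !leNgt -up -dn ui di.
(* A fixed index is its own root, so equal roots give equal indices; its column is 0 for [s] and [t]
   alike. *)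
have ij : i = j by rewrite -(proj1 (fixed_root fi)) -(proj1 (fixed_root fj)).
by apply: Or32; rewrite -ij fi /copy /column fi ltxx.
Qed.

(** The ancestors of [i0] occupy all levels up to [m], so [s k] is seen in the column at level [k]
    or, reversed, at level [m - k]; the bound makes the subtraction from [N] injective. *)
Lemma column_inj s t i0 : a i0 <> b i0 -> level i0 = m -> bounded_upto s -> bounded_upto t ->
  (forall i, column s i = column t i) -> forall k, (k <= m)%N -> s k = t k.
Proof.
move=> ab0 l0 sN tN st k km.
have := st (anc i0 k); have := st (anc i0 (m - k)%N).
rewrite /column !level_ancestor ?l0 ?leq_subr // subKn //.
have [-> ->] := ancestor_dir i0 k; have [ -> ->] := ancestor_dir i0 (m - k).
case: ltgtP ab0 => // _ _ // h _; have := sN k km; have := tN k km; lia.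
Qed.

End Shift.

End Pair.

(** * Vertices of the shift graph as sequences *)

Section ShiftTuples.
Variable m : nat.

Definition tuple_val (s : incr_fun 'I_m.+1 nat) (k : nat) : nat := s (inord k).

Lemma tuple_val_incr s : increasing_upto m (tuple_val s).
Proof.
move=> k l /andP[kl lm]; have kl_ord : (inord k < inord l :> 'I_m.+1)%O.
  by rewrite ltEord !inordK // ltnS // (leq_trans (ltnW kl)).
exact: (incr_homo s kl_ord).
Qed.

Lemma tuple_val_le s k : (tuple_val s k <= s ord_max)%N.
Proof.
have := incr_fun_le s (inord k) ord_max; rewrite /tuple_val leEnat => ->.
by rewrite leEord -ltnS.
Qed.

Lemma tuple_val_inj s t :
  (forall k, (k <= m)%N -> tuple_val s k = tuple_val t k) -> s = t.
Proof.
move=> st; apply: incr_fun_ext => i.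
by have := st i (ltn_ord i); rewrite /tuple_val inord_val.
Qed.

Lemma shift_graph_arrow (s t : shift_graph m.+1 nat) : adj s t ->
  shift_arrow m (tuple_val s) (tuple_val t) \/ shift_arrow m (tuple_val t) (tuple_val s).
Proof.
have shift_lt (u v : incr_fun 'I_m.+1 nat) : (0 < m)%N ->
    (forall i j : 'I_m.+1, nat_of_ord i = (nat_of_ord j).+1 -> u i = v j) ->
    shift_arrow m (tuple_val u) (tuple_val v).
  move=> m0 uv; have uv' k : (k < m)%N -> tuple_val u k.+1 = tuple_val v k.
    by move=> km; apply: uv; rewrite !inordK // ltnS ltnW.
  split=> // [| |k]; [exact: tuple_val_incr|exact: tuple_val_incr|].
  (* The shift says nothing about the last entry of [v], but [u m = v (m - 1) < v m]. *)
  rewrite leq_eqVlt => /predU1P[->|km].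
    rewrite -[in X in (X < _)%N](prednK m0) uv' ?prednK //.
    by apply: tuple_val_incr; rewrite ltn_predL m0 leqnn.
  by rewrite -uv' //; apply: tuple_val_incr; rewrite ltnSn.
case: (posnP m) => [m0 [st _]|m0 [_ [h|h]]]; last 2 first.
- by left; exact: shift_lt.
- by right; exact: shift_lt.
have : tuple_val s 0 <> tuple_val t 0.
  by move=> e; apply: st; apply: tuple_val_inj => k; rewrite m0 leqn0 => /eqP ->.
have arrow u v : (tuple_val u 0 < tuple_val v 0)%N -> shift_arrow m (tuple_val u) (tuple_val v).
  move=> uv; split=> [| |k|k]; [exact: tuple_val_incr|exact: tuple_val_incr| |].
    by rewrite m0.
  by rewrite m0 leqn0 => /eqP ->.
move=> /eqP; rewrite neq_ltn => /orP[h|h]; [left|right]; exact: arrow.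
Qed.

End ShiftTuples.

(** * Finite subgraphs of the shift graph *)

Section BoundedTrees.
Local Open Scope order_scope.
Local Open Scope classical_set_scope.
Local Open Scope card_scope.
Variables (alpha theta mu : ordinal_type) (a b : incr_fun alpha theta) (ab : a <> b).
Variables (m : nat) (i0 : alpha).

Notation level := (level (pair_hi_homo a b) (pair_lo_hi a b)).

Hypotheses (level_le_m : forall i, (level i <= m)%N) (level_i0 : level i0 = m)
  (ab_i0 : a i0 <> b i0).
Hypothesis large_mu : forall V : Type, finite_set [set: V] -> ~ ([set: mu] #<= [set: V * alpha]).
Variables (f : mu -> theta) (f_mono : {mono f : x y / x <= y}).

Lemma contains_shift_graphs : contains_finite_subgraphs (otp_graph ab) (shift_graph m.+1 nat).
Proof.
move=> H Hfin; pose V := graph_of_subgraph H.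
have Vfin : finite_set [set: V] by rewrite (eq_finite_set (card_setT (svert H))).
pose s (v : V) : nat -> nat := @tuple_val m (val v).
(* The reversal in [column] calls for one bound on all entries; the last entries provide it. *)
have [N sN] : exists N, forall v : V, bounded_upto m N (s v).
  have /finite_seqP[l lE] : finite_set [set (val v : incr_fun _ _) ord_max | v in [set: V]].
    exact: finite_image.
  exists (\max_(x <- l) x) => v k _; apply: (leq_trans (tuple_val_le _ _)).
  apply: leq_bigmax_seq => //.
  have : [set` l] ((val v : incr_fun _ _) ord_max) by rewrite -lE; exists v.
  by [].
have sincr v : increasing_upto m (s v) by exact: tuple_val_incr.
pose F (vi : V * alpha) := copy a b m N (s vi.1) vi.2.
(* All copies together form an image of [V * alpha], too small for [mu] to inject into, so they
   embed in [mu] simultaneously. *)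
have [h hP] : exists h : (nat -> alpha + nat) -> mu,
    forall x y, range F x -> ltlex (@lt_sum alpha) m.+2 x y -> h x < h y.
  apply: wf_embedding; [exact/ltlex_wf/lt_sum_wf|exact/ltlex_trans/lt_sum_trans|].
  move=> le_mu; apply: (large_mu Vfin); apply: card_le_trans le_mu _.
  exact: card_image_le.
have f_lt x y : x < y -> f x < f y by rewrite (leW_mono f_mono).
have hF v i w j : ltlex (@lt_sum alpha) m.+2 (F (v, i)) (F (w, j)) -> f (h (F (v, i))) < f (h (F (w, j))).
  by move=> lt_F; apply/f_lt/hP => //; exists (v, i).
have Ghomo v : {homo (fun i => f (h (F (v, i)))) : i j / i < j}.
  by move=> i j ij; apply: hF; exact: copy_homo.
pose G v : otp_graph ab := IncrFun (Ghomo v).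
have Garrow v w : shift_arrow m (s v) (s w) -> same_otp (G v) (G w) a b.
  move=> vw; apply: le_same_otp => i j /=.
  case: (copy_cmp level_le_m i j vw (sN v) (sN w)) => -[cmp_ab cmp_F].
  - have lt_G := hF v i w j cmp_F.
    by rewrite (ltW lt_G) (ltW cmp_ab) (lt_geF lt_G) (lt_geF cmp_ab).
  - have -> : F (v, i) = F (w, j) by exact: cmp_F.
    by rewrite cmp_ab !lexx.
  - have lt_G := hF w j v i cmp_F.
    by rewrite (ltW lt_G) (ltW cmp_ab) (lt_geF lt_G) (lt_geF cmp_ab).
exists G; split=> [v w Gvw|v w].
  (* Keys of the same index with different columns are strictly ordered, so equal images force equal
     columns, which determine the tuple. *)
  apply/val_inj/tuple_val_inj/(column_inj ab_i0 level_i0 (sN v) (sN w)) => i.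
  have Gi : f (h (F (v, i))) = f (h (F (w, i))) := congr1 (fun g : incr_fun _ _ => g i) Gvw.
  have [lt_c|lt_c|//] := ltngtP (column a b m N (s v) i) (column a b m N (s w) i).
    have : f (h (F (v, i))) < f (h (F (w, i))) by apply: hF; exact: key_lt_col.
    by rewrite Gi ltxx.
  have : f (h (F (w, i))) < f (h (F (v, i))) by apply: hF; exact: key_lt_col.
  by rewrite Gi ltxx.
by move=> /sadj_sub[_ _ /shift_graph_arrow[|] vw]; [left|right]; exact: Garrow.
Qed.

End BoundedTrees.

Theorem theorem4p8 (alpha theta : ordinal_type)
    (theta_infinite : infinite_set [set: theta]%classic)
    (* |alpha|^+ + aleph_0 < theta *)
    (alpha_succ : Type) (alpha_succP : is_succ_card alpha alpha_succ)
    (mu : ordinal_type) (muP : is_card_of (alpha_succ + nat)%type mu)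
    (mu_lt_theta : ord_lt mu theta)
    (a b : incr_fun alpha theta) (ab : a <> b)
    (* chi(G) > beth_2(aleph_0) *)
    (chi : Type) (chiP : is_chromatic_number (otp_graph ab) chi)
    (chi_gt : card_lt (beth 2 nat) chi) :
  exists m : nat, (1 <= m)%N /\
    contains_finite_subgraphs (otp_graph ab) (shift_graph m nat).
Proof.
pose level := level (pair_hi_homo a b) (pair_lo_hi a b).
have no_colouring : ~ exists g : incr_fun alpha theta -> nat -> nat,
    forall v w, same_otp v w a b -> g v <> g w.
  move=> [g gP]; case: chi_gt => _; apply; apply: card_le_trans beth2_sequences.
  by apply: chiP.2; exists g => v w [/gP //|/gP/nesym].
have [N levelN] : exists N, forall i, a i <> b i -> (level i < N)%N.
  apply: contrapT => unb; apply/no_colouring/unbounded_level_colouring.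
  apply: contrapT => /not_orP[/existsNP[p pP] /existsNP[q qP]].
  apply: unb; exists (maxn p q) => i /eqP; rewrite neq_lt leq_max => /orP[abi|bai].
    by apply/orP; left; rewrite ltnNge; apply/negP => pi; apply: pP; exists i.
  by apply/orP; right; rewrite ltnNge; apply/negP => qi; apply: qP; exists i.
(* The maximum is taken over indices with [a i <> b i], so that [column_inj] applies where it is
   attained; fixed indices have level 0. *)
pose P k := `[< exists i, a i <> b i /\ level i = k >].
have exP : exists k, P k.
  have [i abi] : exists i, a i <> b i.
    apply: contrapT => nab; apply/ab/incr_fun_ext => i.
    by apply: contrapT => abi; apply: nab; exists i.
  by exists (level i); apply/asboolP; exists i.
have ubP k : P k -> (k <= N)%N by move=> /asboolP[i [/levelN/ltnW li <-]].
have [m /asboolP[i0 [abi0 li0]] mmax] := ex_maxnP exP ubP.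
have [f [c [f_mono _]]] := mu_lt_theta.
exists m.+1; split=> //; apply: (contains_shift_graphs _ _ li0 abi0 _ f_mono).
  move=> i; have [/fixed_root[_ ->] //|/eqP abi] := eqVneq (a i) (b i).
  by apply: mmax; apply/asboolP; exists i.
move=> V Vfin; apply: (not_card_le_countable_prod alpha_succP muP.2) => //.
exact: finite_set_countable.
Qed.
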